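(* Let $G$ be an abelian group of finite rank, and let $\varphi,\psi \colon G \to G$ be endomorphisms such that $(\varphi,\psi)$ is tame. Let $T \le G$ denote the torsion subgroup of $G$, and write $\tilde\varphi,\tilde\psi \colon G/T \to G/T$ and $\varphi_0,\psi_0 \colon T \to T$ for the induced endomorphisms. Then $(\tilde\varphi,\tilde\psi)$ and $(\varphi_0,\psi_0)$ are tame and \[ Z_{\varphi,\psi}(s) = Z_{\tilde\varphi,\tilde\psi}(s) \ast Z_{\varphi_0,\psi_0}(s) \] is an additive convolution.
   Context: Maps are written on the right. For endomorphisms $\varphi,\psi$ of a group $G$, elements $x,y \in G$ are $(\varphi,\psi)$-twisted conjugate if there is $g \in G$ with $x = (g\varphi)^{-1} y (g\psi)$. This is an equivalence relation, and $R(\varphi,\psi)$ denotes the number of its classes. The pair $(\varphi,\psi)$ is tame if $R(\varphi^n,\psi^n)$ is finite for all $n \in \mathbb{N} = \{1,2,\ldots\}$. For a tame pair, \[ Z_{\varphi,\psi}(s) = \exp\left( \sum_{n=1}^\infty \frac{R(\varphi^n,\psi^n)}{n} s^n \right). \] A group has finite (Prüfer) rank if there is an integer $r$ such that every finitely generated subgroup can be generated by $r$ elements. The additive convolution of $F(s) = \exp\left(\sum_{n=1}^\infty \frac{a_n}{n} s^n\right)$ and $H(s) = \exp\left(\sum_{n=1}^\infty \frac{b_n}{n} s^n\right)$ is $(F \ast H)(s) = \exp\left(\sum_{n=1}^\infty \frac{a_n b_n}{n} s^n\right)$. *)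

(* Defs.v *)
From HB Require Import structures.
From mathcomp Require Import all_boot all_order all_algebra.
From mathcomp Require Import finmap.
From mathcomp Require Import boolp classical_sets functions cardinality.

Set Implicit Arguments.
Unset Strict Implicit.
Unset Printing Implicit Defensive.

Import Order.TTheory GRing.Theory Num.Theory.
Local Open Scope classical_set_scope.
Local Open Scope ring_scope.
Local Open Scope quotient_scope.

(** Abelian groups are written additively. *)

Section TwistedConjugacy.
Variable G : zmodType.

(* x = (g phi)^-1 y (g psi) in additive notation *)
Definition twisted_conj (phi psi : G -> G) (x y : G) : Prop :=
  exists g : G, x = - phi g + y + psi g.

Lemma twisted_conj_refl (phi psi : {additive G -> G}) x :
  twisted_conj phi psi x x.
Proof. by exists 0; rewrite !raddf0 add0r addr0. Qed.

Lemma twisted_conj_sym (phi psi : {additive G -> G}) x y :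
  twisted_conj phi psi x y -> twisted_conj phi psi y x.
Proof.
move=> [g ->]; exists (- g); rewrite !raddfN opprK.
by rewrite !addrA subrr add0r addrK.
Qed.

Lemma twisted_conj_trans (phi psi : {additive G -> G}) x y z :
  twisted_conj phi psi x y -> twisted_conj phi psi y z ->
  twisted_conj phi psi x z.
Proof.
move=> [g ->] [h ->]; exists (g + h).
by rewrite (raddfD phi) (raddfD psi) opprD -!addrA (addrC (psi h)).
Qed.

Definition twisted_classes (phi psi : G -> G) : set (set G) :=
  range (fun y : G => [set x | twisted_conj phi psi x y]).

(* The number R(phi, psi); meaningful when there are finitely many classes
   (it is 0 otherwise). *)
Definition reidemeister_number (phi psi : G -> G) : nat :=
  #|` fset_set (twisted_classes phi psi)|%fset.

Definition tame (phi psi : G -> G) : Prop :=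
  forall n : nat, (0 < n)%N ->
    finite_set (twisted_classes (iter n phi) (iter n psi)).

End TwistedConjugacy.

Section FiniteRank.
Variable G : zmodType.

Definition generated_subgroup (A : set G) : set G :=
  smallest [set H : set G | zmod_closed (fun x => x \in H)] A.

(* Pruefer rank: in an r-tuple repetitions and zeros are allowed, so this is
   generation by at most r elements. *)
Definition finite_rank : Prop :=
  exists r : nat, forall s : seq G, exists t : r.-tuple G,
    generated_subgroup [set` s] = generated_subgroup [set` t].

End FiniteRank.

Section Torsion.
Variable G : zmodType.

Definition torsion : {pred G} :=
  fun x => `[< exists n : nat, (0 < n)%N /\ x *+ n = 0 >].

Lemma torsionP x :
  reflect (exists n : nat, (0 < n)%N /\ x *+ n = 0) (x \in torsion).
Proof. exact: asboolP. Qed.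

Lemma torsion_zmod_closed : zmod_closed torsion.
Proof.
split; first by apply/torsionP; exists 1%N.
move=> x y /torsionP[m [m0 xm]] /torsionP[n [n0 yn]].
apply/torsionP; exists (m * n)%N; split; first by rewrite muln_gt0 m0.
by rewrite mulrnBl mulrnA xm mul0rn mulnC mulrnA yn mul0rn subr0.
Qed.

HB.instance Definition _ :=
  GRing.isZmodClosed.Build G torsion torsion_zmod_closed.

Definition torsion_subgroup := {x : G | x \in torsion}.

HB.instance Definition _ := SubChoice.on torsion_subgroup.
HB.instance Definition _ :=
  [SubChoice_isSubZmodule of torsion_subgroup by <:].

Definition torsion_quotient := Quotient.quot torsion.

HB.instance Definition _ := ZmodQuotient.on torsion_quotient.

Lemma torsion_quotientP (x y : G) :
  \pi_torsion_quotient x = \pi_torsion_quotient y <-> x - y \in torsion.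
Proof.
rewrite -Quotient.equivE; split.
  by move/eqP; rewrite eqmodE.
by move=> h; apply/eqP; rewrite eqmodE.
Qed.

Variable phi : {additive G -> G}.

Lemma torsion_stable x : x \in torsion -> phi x \in torsion.
Proof.
move=> /torsionP[n [n0 xn]]; apply/torsionP; exists n; split => //.
by rewrite -raddfMn xn raddf0.
Qed.

Definition torsion_endo (x : torsion_subgroup) : torsion_subgroup :=
  Sub (phi (val x)) (torsion_stable (valP x)).

Lemma torsion_endoE x : val (torsion_endo x) = phi (val x).
Proof. by []. Qed.

Lemma torsion_endo_is_zmod_morphism : zmod_morphism torsion_endo.
Proof. by move=> x y; apply: val_inj; rewrite /= raddfB. Qed.

HB.instance Definition _ := GRing.isZmodMorphism.Build
  torsion_subgroup torsion_subgroup torsion_endo torsion_endo_is_zmod_morphism.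

Definition quotient_endo (x : torsion_quotient) : torsion_quotient :=
  \pi_torsion_quotient (phi (repr x)).

Lemma quotient_endoE (x : G) :
  quotient_endo (\pi_torsion_quotient x) = \pi_torsion_quotient (phi x).
Proof.
apply/torsion_quotientP; rewrite -raddfB; apply: torsion_stable.
by apply/torsion_quotientP; rewrite reprK.
Qed.

Lemma quotient_endo_is_zmod_morphism : zmod_morphism quotient_endo.
Proof.
move=> x y; rewrite -[x]reprK -[y]reprK -raddfB !quotient_endoE.
by rewrite !raddfB.
Qed.

HB.instance Definition _ := GRing.isZmodMorphism.Build
  torsion_quotient torsion_quotient quotient_endo
  quotient_endo_is_zmod_morphism.

End Torsion.

(** Formal power series over [K] are given by their coefficients [nat -> K]. *)
Section FormalSeries.
Variable K : numFieldType.

Definition fps_mul (A B : nat -> K) : nat -> K :=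
  fun n => \sum_(i < n.+1) A i * B (n - i)%N.

Definition fps_pow (A : nat -> K) (k : nat) : nat -> K :=
  iter k (fps_mul A) (fun n => (n == 0%N)%:R).

(* Used for A with A 0 = 0: then A^k has no term of degree < k, so the
   coefficient of degree n of \sum_k A^k / k! only involves k <= n. *)
Definition fps_exp (A : nat -> K) : nat -> K :=
  fun n => \sum_(k < n.+1) (k`!)%:R^-1 * fps_pow A k n.

(* \sum_(n >= 1) (a_n / n) s^n; the value a 0 is irrelevant *)
Definition log_series (a : nat -> K) : nat -> K :=
  fun n => if n is 0 then 0 else a n / n%:R.

Definition exp_series (a : nat -> K) : nat -> K := fps_exp (log_series a).

(* For F = exp_series a and H = exp_series b, the sequences a and b are unique
   in positive degrees (exp_series_inj), so that the set below is the singleton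
   {exp_series (a_n b_n)_n} (additive_convolutionE). *)
Definition additive_convolution (F H : nat -> K) : nat -> K :=
  xget (fun=> 0) [set E : nat -> K | exists a b : nat -> K,
    [/\ F = exp_series a, H = exp_series b &
        E = exp_series (fun n => a n * b n)]].

Lemma fps_pow_ext (A B : nat -> K) n :
  (forall i, (i <= n)%N -> A i = B i) ->
  forall k m, (m <= n)%N -> fps_pow A k m = fps_pow B k m.
Proof.
move=> AB; elim=> [|k IH] m mn //=.
rewrite /fps_mul; apply: eq_bigr => i _.
rewrite AB; last by rewrite (leq_trans _ mn) // -ltnS.
by congr (_ * _); apply: IH; rewrite (leq_trans (leq_subr _ _)).
Qed.

Lemma fps_pow_ext_lt (A B : nat -> K) n : A 0%N = 0 -> B 0%N = 0 ->
  (forall i, (i < n)%N -> A i = B i) ->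
  forall k, k != 1%N -> fps_pow A k n = fps_pow B k n.
Proof.
move=> A0 B0 AB [//|[//|k]] _.
apply: eq_bigr => -[i /= ilt] _; rewrite -!/(fps_pow _ k.+1).
case: i ilt => [|i] ilt; first by rewrite A0 B0 !mul0r.
rewrite ltnS in ilt.
have [eqn|neqn] := eqVneq i.+1 n.
  rewrite eqn subnn /= /fps_mul !big_ord_recl !big_ord0.
  by rewrite A0 B0 !mul0r !addr0 !mulr0.
have lt_in : (i.+1 < n)%N by rewrite ltn_neqAle neqn.
rewrite AB //; congr (_ * _).
apply: (@fps_pow_ext A B (n - i.+1) _ k.+1 (n - i.+1)) => // j jle.
by apply: AB; rewrite (leq_ltn_trans jle) // ltn_subrL /=; case: (n) lt_in.
Qed.

Lemma fps_pow1 (A : nat -> K) n : fps_pow A 1 n = A n.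
Proof.
rewrite /fps_pow /= /fps_mul big_ord_recr /= subnn eqxx mulr1 big1 ?add0r //.
by move=> i _; rewrite subn_eq0 leqNgt ltn_ord mulr0.
Qed.

Lemma exp_series_inj (a b : nat -> K) : exp_series a = exp_series b ->
  forall n, (0 < n)%N -> a n = b n.
Proof.
move=> eab; suff logE n : log_series a n = log_series b n.
  move=> [//|n] _; have := logE n.+1 => /=.
  by apply: mulIf; rewrite invr_eq0 pnatr_eq0.
elim/ltn_ind: n => -[//|n] IH.
have := congr1 (fun F => F n.+1) eab; rewrite /exp_series /fps_exp.
pose k1 : 'I_n.+2 := Ordinal (isT : (1 < n.+2)%N).
rewrite (bigD1 k1) // [RHS](bigD1 k1) // -[nat_of_ord k1]/1%N !fps_pow1 invr1 !mul1r.
rewrite (eq_bigr (fun k : 'I_n.+2 =>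
  (k`!)%:R^-1 * fps_pow (log_series b) k n.+1)); first by move/addIr.
move=> k neq; congr (_ * _); apply: fps_pow_ext_lt => //.
Qed.

Lemma exp_series_ext (a b : nat -> K) :
  (forall n, (0 < n)%N -> a n = b n) -> exp_series a = exp_series b.
Proof.
move=> ab; congr fps_exp; apply/funext => -[//|n] /=.
by rewrite ab.
Qed.

Lemma additive_convolutionE (a b : nat -> K) :
  additive_convolution (exp_series a) (exp_series b) =
  exp_series (fun n => a n * b n).
Proof.
rewrite /additive_convolution; case: xgetP => [E _|] /=.
  move=> [a' [b' [/exp_series_inj ea /exp_series_inj eb ->]]].
  by apply: exp_series_ext => n n0; rewrite ea ?eb.
by move=> /(_ (exp_series (fun n => a n * b n)))[]; exists a, b.
Qed.

(* Z_{phi,psi}(s), meaningful for a tame pair *)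
Definition reidemeister_zeta (G : zmodType) (phi psi : G -> G) : nat -> K :=
  exp_series (fun n => (reidemeister_number (iter n phi) (iter n psi))%:R).

End FormalSeries.

Arguments reidemeister_zeta K {G} phi psi.

(* Main.v *)
Require Import Defs.
From HB Require Import structures.
From mathcomp Require Import all_boot all_order all_algebra.
From mathcomp Require Import finmap.
From mathcomp Require Import boolp classical_sets functions cardinality.

Set Implicit Arguments.
Unset Strict Implicit.
Unset Printing Implicit Defensive.

Import GRing.Theory.
Local Open Scope classical_set_scope.
Local Open Scope ring_scope.
Local Open Scope quotient_scope.

(** Two elements are twisted conjugate under [(f, g)] exactly when they differ
by a value of [d := g - f], so [R(f, g)] is the order of the cokernel of [d].
The theorem therefore amounts to [|coker d| = |coker d_Q| * |coker d_T|], where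
[d_Q] and [d_T] are induced by [d := psi^n - phi^n] on the torsion quotient and
on the torsion subgroup.

The snake lemma for [0 -> T -> G -> G/T -> 0] gives an exact sequence
[ker d_Q -> coker d_T -> coker d -> coker d_Q -> 0], so the point is that [d_Q]
is injective, that is, that [d x] torsion forces [x] torsion.  This is where
finite rank enters ([torsion_reflected]).  As the cokernel of [d] is finite,
every element of [G] has a positive multiple in the image of [d].  If some
non-torsion [x_0] had [d x_0 = 0], one could pull multiples back repeatedly and
get [x_0, x_1, x_2, ...] with [d x_(k+1)] a positive multiple of [x_k].  As
[d^k] kills [x_j] for [j < k] and sends [x_k] to a positive multiple of [x_0],
this sequence would be linearly independent over the integers, whereas in a
group of finite rank all long enough families are dependent
([finite_rank_dependent]).

Given injectivity of [d_Q], the classes of [T] are the traces of classes of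
[G], those of [G/T] are the images of classes of [G], and sums of
representatives for [G/T] and for [T] represent each class of [G] once
([reidemeister_number_mul]).  The identity of zeta functions is then the
equality of coefficients [R(phi^n, psi^n)], since the induced endomorphisms
commute with iteration. *)

(** * Counting twisted conjugacy classes by representatives *)

Section Transversals.
Variable G : zmodType.

Lemma twisted_conjE (phi psi : G -> G) (x y : G) :
  twisted_conj phi psi x y <-> exists g, x - y = (psi \- phi) g.
Proof.
split=> [[g ->]|[g /= /eqP]]; exists g; first by rewrite /= addrAC addrK addrC.
by apply/eqP; rewrite addrAC [- phi g + _]addrC -subr_eq.
Qed.

Variables phi psi : {additive G -> G}.

Definition twisted_transversal (I : Type) (t : I -> G) : Prop :=
  (forall i j, twisted_conj phi psi (t i) (t j) -> i = j) /\
  (forall x, exists i, twisted_conj phi psi x (t i)).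

Lemma twisted_class_eq (x y : G) :
  [set z | twisted_conj phi psi z x] = [set z | twisted_conj phi psi z y] <->
  twisted_conj phi psi x y.
Proof.
split=> [exy|xy].
  suff : [set z | twisted_conj phi psi z y] x by [].
  by rewrite -exy /=; exact: twisted_conj_refl.
apply/seteqP; split=> z /= h; first exact: twisted_conj_trans h xy.
exact: twisted_conj_trans h (twisted_conj_sym xy).
Qed.

Lemma twisted_transversal_card (I : finType) (t : I -> G) :
  twisted_transversal t -> reidemeister_number phi psi = #|I|.
Proof.
move=> [tinj tsurj]; pose F i := [set x | twisted_conj phi psi x (t i)].
have -> : reidemeister_number phi psi = #|` [fset F i | i in I]|%fset.
  congr (size (enum_fset _)); apply/fsetP => A.
  have classesE : twisted_classes phi psi = range F.
    apply/seteqP; split=> _ [y _ <-]; last by exists (t y).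
    by have [i yi] := tsurj y; exists i => //; apply/esym/twisted_class_eq.
  rewrite classesE in_fset_set; last first.
    exact: finite_image (@finite_finset I _).
  apply/idP/imfsetP => [/set_mem[i _ <-]|[i _ ->]]; first by exists i.
  by apply/mem_set; exists i.
by rewrite card_imfset /= ?cardE // => i j /twisted_class_eq/tinj.
Qed.

(** Together with [twisted_transversal_card], this replaces cardinalities of
sets of classes by families of representatives, which can be added. *)
Lemma twisted_transversal_exists :
  finite_set (twisted_classes phi psi) ->
  exists t : 'I_(reidemeister_number phi psi) -> G, twisted_transversal t.
Proof.
move=> fin; pose C := fset_set (twisted_classes phi psi).
have cardC : #|{: C}| = reidemeister_number phi psi by rewrite -cardfE.
have rep (c : C) : exists y, [set x | twisted_conj phi psi x y] = val c.
  have : val c \in twisted_classes phi psi by rewrite -in_fset_set // fsvalP.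
  by move=> /set_mem[y _ <-]; exists y.
have [r rE] := choice rep.
pose t (i : 'I_(reidemeister_number phi psi)) :=
  r (enum_val (cast_ord (esym cardC) i)).
exists t; split=> [i j /twisted_class_eq|x].
  by rewrite !rE => /val_inj/enum_val_inj/cast_ord_inj.
have xC : [set z | twisted_conj phi psi z x] \in C.
  by rewrite in_fset_set //; apply/mem_set; exists x.
exists (cast_ord cardC (enum_rank [` xC]%fset)).
by rewrite /t cast_ordK enum_rankK; apply/twisted_class_eq; rewrite rE.
Qed.

End Transversals.

(** * Linear dependence in groups of finite rank *)

Section LinearDependence.

Lemma rat_common_denominator (n : nat) (v : 'rV[rat]_n) :
  exists2 d : int, d != 0 &
    exists c : 'I_n -> int, forall i, (c i)%:~R = d%:~R * v 0 i.
Proof.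
exists (\prod_(j < n) denq (v 0 j)).
  by apply/prodf_neq0 => j _; rewrite denq_neq0.
exists (fun i => (\prod_(j < n | j != i) denq (v 0 j)) * numq (v 0 i)) => i.
by rewrite [in RHS](bigD1 i) //= !intrM numqE mulrC mulrAC [in RHS]mulrAC mulrAC
  [v 0 i * _]mulrC.
Qed.

(** Over the rationals the left kernel is nonzero for reasons of rank; clearing
denominators in one of its vectors gives an integral relation. *)
Lemma int_rows_dependent (m n : nat) (A : 'M[int]_(m, n)) : (n < m)%N ->
  exists2 c : 'I_m -> int, (exists i, c i != 0)
    & forall j, \sum_(i < m) c i * A i j = 0.
Proof.
move=> lt_nm; pose B := map_mx (intr : int -> rat) A.
have kerN0 : kermx B != 0.
  rewrite kermx_eq0 /row_free neq_ltn; apply/orP; left.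
  exact: leq_ltn_trans (rank_leq_col B) lt_nm.
pose v := nz_row (kermx B).
have [d dN0 [c cE]] := rat_common_denominator v.
exists c => [|j].
  have /rV0Pn[i vi] : v != 0 by rewrite nz_row_eq0.
  by exists i; rewrite -(intr_eq0 rat) cE mulf_neq0 // intr_eq0.
apply/eqP; rewrite -(intr_eq0 rat) rmorph_sum /=.
have /matrixP/(_ 0 j) : v *m B = 0 by apply/sub_kermxP; exact: nz_row_sub.
rewrite !mxE => vB; apply/eqP.
rewrite -[RHS](mulr0 d%:~R) -[in RHS]vB mulr_sumr; apply: eq_bigr => i _.
by rewrite intrM cE mulrA mxE.
Qed.

Variable G : zmodType.

Lemma generated_subgroup_comb (r : nat) (t : r.-tuple G) (y : G) :
  generated_subgroup [set` t] y ->
  exists c : 'I_r -> int, y = \sum_(j < r) tnth t j *~ c j.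
Proof.
pose H := [set z | exists c : 'I_r -> int, z = \sum_(j < r) tnth t j *~ c j].
apply: (_ : _ `<=` H); apply: smallest_sub => [|_ /= /tnthP[j ->]].
  split=> [|_ _ /set_mem[c ->] /set_mem[e ->]].
    by apply/mem_set; exists (fun=> 0); rewrite big1.
  apply/mem_set; exists (fun j => c j - e j); rewrite -sumrB.
  by apply: eq_bigr => j _; rewrite mulrzBr.
exists (fun k => (k == j)%:Z); rewrite (bigD1 j) //= eqxx mulr1z big1 ?addr0 //.
by move=> k /negPf ->; rewrite mulr0z.
Qed.

(** Elements of a subgroup generated by [r] elements are integral combinations
of these, so that [r + 1] of them have linearly dependent coefficient rows. *)
Lemma finite_rank_dependent : finite_rank G ->
  exists m : nat, forall x : 'I_m -> G,
    exists2 c : 'I_m -> int, (exists i, c i != 0) & \sum_(i < m) x i *~ c i = 0.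
Proof.
move=> [r hr]; exists r.+1 => x.
have [t tE] := hr (codom x).
have comb i : exists c : 'I_r -> int, x i = \sum_(j < r) tnth t j *~ c j.
  apply: generated_subgroup_comb; rewrite -tE.
  by apply: sub_gen_smallest; exact: codom_f.
have [a aE] := choice comb.
have [c cN0 cA] := int_rows_dependent (\matrix_(i, j) a i j) (ltnSn r).
exists c => //.
under eq_bigr do rewrite aE mulrz_suml.
rewrite exchange_big big1 //= => j _.
under eq_bigr do rewrite -mulrzA.
rewrite -mulrz_sumr -[RHS](mulr0z (tnth t j)) -[in RHS](cA j).
by congr (_ *~ _); apply: eq_bigr => i _; rewrite mxE mulrC.
Qed.

End LinearDependence.

(** * Induced endomorphisms and iteration *)

Section Iterates.
Variables (G : zmodType) (phi : {additive G -> G}).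

Lemma iter_is_zmod_morphism n : zmod_morphism (iter n phi).
Proof. by move=> x y; elim: n => //= n ->; rewrite raddfB. Qed.

HB.instance Definition _ n :=
  GRing.isZmodMorphism.Build G G (iter n phi) (iter_is_zmod_morphism n).

Lemma iter_quotient_endo n :
  iter n (quotient_endo phi) = quotient_endo (iter n phi).
Proof.
apply/funext => x; rewrite -[x]reprK quotient_endoE.
by elim: n => //= n ->; rewrite quotient_endoE.
Qed.

Lemma iter_torsion_endo n :
  iter n (torsion_endo phi) = torsion_endo (iter n phi).
Proof.
apply/funext => x; apply: val_inj; rewrite torsion_endoE.
by elim: n => //= n <-.
Qed.

End Iterates.

(** * Endomorphisms with finite cokernel are injective modulo torsion *)

Section TorsionReflection.
Variable G : zmodType.

Lemma nontorsion_mulrz_eq0 (x : G) (c : int) :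
  x \notin @torsion G -> x *~ c = 0 -> c = 0.
Proof.
move=> /torsionP xtor xc; apply: contra_not_eq xtor => cN0.
exists `|c|%N; split; first by rewrite absz_gt0.
case: c xc {cN0} => n //=.
by rewrite NegzE mulrNz => /eqP; rewrite oppr_eq0 => /eqP.
Qed.

Lemma torsion_mulrn (x : G) n :
  (0 < n)%N -> x *+ n \in @torsion G -> x \in @torsion G.
Proof.
move=> n0 /torsionP[m [m0 xnm]]; apply/torsionP; exists (n * m)%N.
by rewrite muln_gt0 n0 mulrnA.
Qed.

Variable d : {additive G -> G}.

(** The image of [d] has full rational rank, and in finite rank a surjective
linear map is injective.  The proof avoids tensoring with the rationals: a
non-torsion element of the kernel would start a backward orbit whose members
are independent. *)
Lemma torsion_reflected : finite_rank G ->
    (forall y, exists n z, (0 < n)%N /\ d z = y *+ n) ->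
  forall x, d x \in @torsion G -> x \in @torsion G.
Proof.
move=> hrank hcoker x /torsionP[m [m0 dxm]]; apply: (torsion_mulrn m0).
(* A multiple [x0] of [x] lies in the kernel of [d] itself. *)
rewrite -raddfMn in dxm; move: {x m m0} (x *+ m) dxm => x0 dx0.
apply/negPn/negP => x0N.
have [step stepP] :
    {step & forall y, exists2 n, (0 < n)%N & d (step y) = y *+ n}.
  apply: (@choice _ _ (fun y z => exists2 n, (0 < n)%N & d z = y *+ n)).
  by move=> y; have [n [z [n0 dz]]] := hcoker y; exists z, n.
pose x k := iter k step x0.
have dx k : exists2 n, (0 < n)%N & iter k d (x k) = x0 *+ n.
  elim: k => [|k [n n0 IH]]; first by exists 1%N.
  have [p p0 dp] := stepP (x k); exists (n * p)%N; first by rewrite muln_gt0 n0.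
  by rewrite iterSr /= dp raddfMn /= IH mulrnA.
have dx0k i j : (j < i)%N -> iter i d (x j) = 0.
  move=> ji; have [n _ dn] := dx j.
  rewrite -(subnK ji) addnS -addSn iterD dn raddfMn /= -iterS iterSr dx0.
  by rewrite raddf0 mul0rn.
have [r /(_ (fun i => x i))[c [i0 ci0] cx]] := finite_rank_dependent hrank.
(* With [i] the last index of a nonzero coefficient, [iter i d] reduces the
   relation to its term of index [i]. *)
case: (@arg_maxnP _ i0 (fun i => c i != 0) (fun i => nat_of_ord i) ci0).
move=> i ci imax.
have := congr1 (iter i d) cx; rewrite raddf0 raddf_sum (bigD1 i) //= big1 ?addr0.
  have [n n0 dn] := dx i; rewrite raddfMz /= dn pmulrn -mulrzA.
  move=> /(nontorsion_mulrz_eq0 x0N)/eqP; rewrite mulf_eq0 (negPf ci) orbF.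
  by rewrite -[_ == _]/(n == 0%N) eqn0Ngt n0.
move=> j ji; rewrite raddfMz /=; have [jlt|ijle] := ltnP j i.
  by rewrite dx0k // mul0rz.
have [->|cj] := eqVneq (c j) 0; first by rewrite mulr0z.
have le_ji : (j <= i)%N := imax j cj.
by rewrite -val_eqE /= eqn_leq le_ji ijle in ji.
Qed.

End TorsionReflection.

(** * Multiplicativity of the Reidemeister number *)

Section Reidemeister.
Variables (G : zmodType) (phi psi : {additive G -> G}).

(** Among the multiples [0, y, 2y, ...] two lie in the same class, and their
difference is in the image of [psi - phi]. *)
Lemma finite_twisted_classes_multiple :
  finite_set (twisted_classes phi psi) ->
  forall y, exists n z, (0 < n)%N /\ (psi \- phi) z = y *+ n.
Proof.
move=> /twisted_transversal_exists[t [_ tsurj]] y.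
have [s sP] := choice tsurj.
pose f (k : 'I_(reidemeister_number phi psi).+1) := s (y *+ k).
have /injectivePn[i [j ij fij]] : ~~ injectiveb f.
  by apply/injectiveP => /leq_card; rewrite !card_ord ltnn.
wlog lt_ij : i j ij fij / (i < j)%N => [hw|].
  have [lt|lt|/val_inj eq] := ltngtP i j; first exact: hw lt.
    by apply: hw lt => //; rewrite eq_sym.
  by rewrite eq eqxx in ij.
have /twisted_conj_sym si : twisted_conj phi psi (y *+ i) (t (f i)) by exact: sP.
rewrite fij in si; have sj : twisted_conj phi psi (y *+ j) (t (f j)) := sP _.
have /twisted_conjE[z zE] := twisted_conj_trans sj si.
exists (j - i)%N, z; split; first by rewrite subn_gt0.
by rewrite mulrnBr // ltnW.
Qed.

Lemma quotient_twisted_conj x y :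
  twisted_conj (quotient_endo phi) (quotient_endo psi)
    (\pi_(torsion_quotient G) x) (\pi_(torsion_quotient G) y) <->
  exists g, x - y - (psi \- phi) g \in @torsion G.
Proof.
rewrite twisted_conjE; split=> -[g].
  rewrite -[g]reprK /= !quotient_endoE -!raddfB => /torsion_quotientP.
  by exists (repr g).
move=> /torsion_quotientP h; exists (\pi_(torsion_quotient G) g).
by rewrite /= !quotient_endoE -!raddfB; exact: h.
Qed.

Hypothesis finC : finite_set (twisted_classes phi psi).

(** Every class of the quotient is the image of a class of [G]. *)
Lemma quotient_twisted_classes_finite :
  finite_set (twisted_classes (quotient_endo phi) (quotient_endo psi)).
Proof.
pose F (A : set G) := [set \pi_(torsion_quotient G) x | x in A].
apply: sub_finite_set (finite_image F finC) => _ [y _ <-].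
exists [set x | twisted_conj phi psi x (repr y)]; first by exists (repr y).
apply/seteqP; split=> [_ [x /twisted_conjE[g xg] <-]|x /=] /=.
  by rewrite -[y]reprK; apply/quotient_twisted_conj; exists g;
    rewrite xg subrr rpred0.
rewrite -[x]reprK -{1}[y]reprK => /quotient_twisted_conj[g hg].
exists (repr y + (psi \- phi) g).
  by apply/twisted_conjE; exists g; rewrite addrAC subrr add0r.
apply/torsion_quotientP; rewrite -opprB rpredN.
by rewrite opprD addrA.
Qed.

Hypothesis reflected : forall x,
  (psi \- phi) x \in @torsion G -> x \in @torsion G.

(** If [psi g - phi g] is a difference of torsion elements, then [g] itself is
torsion, so [T] has no fewer conjugating elements than [G] for a pair in [T]. *)
Lemma torsion_twisted_conj (x y : torsion_subgroup G) :
  twisted_conj (torsion_endo phi) (torsion_endo psi) x y <->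
  twisted_conj phi psi (val x) (val y).
Proof.
split=> [[g ->]|/twisted_conjE[g xg]].
  by exists (val g); rewrite !raddfD raddfN.
have gtor : g \in @torsion G.
  by apply: reflected; move: (rpredB (valP x) (valP y)); rewrite xg.
apply/twisted_conjE; exists (Sub g gtor); apply: val_inj.
by rewrite !raddfB.
Qed.

(** Every class of [T] is the trace on [T] of a class of [G]. *)
Lemma torsion_twisted_classes_finite :
  finite_set (twisted_classes (torsion_endo phi) (torsion_endo psi)).
Proof.
pose F (A : set G) := [set x : torsion_subgroup G | A (val x)].
apply: sub_finite_set (finite_image F finC) => _ [y _ <-].
exists [set x | twisted_conj phi psi x (val y)]; first by exists (val y).
by apply/seteqP; split=> x /torsion_twisted_conj.
Qed.

(** Representatives of the classes of [G/T], lifted to [G], plus representatives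
of the classes of [T] form a transversal of [G]: reducing modulo [T] separates
the first summands, and [torsion_twisted_conj] separates the second ones. *)
Lemma reidemeister_number_mul :
  reidemeister_number phi psi =
    (reidemeister_number (quotient_endo phi) (quotient_endo psi) *
     reidemeister_number (torsion_endo phi) (torsion_endo psi))%N.
Proof.
have [q [qinj qsurj]] :=
  twisted_transversal_exists quotient_twisted_classes_finite.
have [s [sinj ssurj]] :=
  twisted_transversal_exists torsion_twisted_classes_finite.
pose t (ij : 'I_(reidemeister_number (quotient_endo phi) (quotient_endo psi)) *
             'I_(reidemeister_number (torsion_endo phi) (torsion_endo psi))) :=
  repr (q ij.1) + val (s ij.2).
have tT : twisted_transversal phi psi t.
  split=> [[i j] [i' j']|x].
    rewrite /t /= => h.
    have eii : i = i'.
      apply: qinj; rewrite -[q i]reprK -[q i']reprK.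
      apply/quotient_twisted_conj.
      have /twisted_conjE[g hg] := h; exists g; rewrite -hg.
      rewrite [X in _ - X](_ : _ =
        (repr (q i) - repr (q i')) + (val (s j) - val (s j'))).
        rewrite opprD addrA subrr add0r opprB.
        exact: rpredB (valP _) (valP _).
      by rewrite opprD addrACA.
    rewrite -eii in h *; congr pair.
    apply: sinj; apply/torsion_twisted_conj/twisted_conjE.
    have /twisted_conjE[g hg] := h; exists g; rewrite -hg.
    by rewrite [in RHS]opprD addrACA subrr add0r.
  have [i] := qsurj (\pi_(torsion_quotient G) x).
  rewrite -[q i]reprK => /quotient_twisted_conj[g xg].
  pose u : torsion_subgroup G := Sub (x - repr (q i) - (psi \- phi) g) xg.
  have [j /torsion_twisted_conj/twisted_conjE[h]] := ssurj u.
  move=> hE; exists (i, j); apply/twisted_conjE; exists (g + h).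
  have -> : (psi \- phi) (g + h) = (psi \- phi) g + (psi \- phi) h.
    exact: raddfD.
  rewrite -hE /t [val u]/=.
  by rewrite [RHS]addrC addrAC subrK opprD addrA.
by rewrite (twisted_transversal_card tT) card_prod !card_ord.
Qed.

End Reidemeister.

Theorem corollary3p2 (K : numFieldType) (G : zmodType)
    (phi psi : {additive G -> G})
    (hrank : finite_rank G) (htame : tame phi psi) :
  [/\ tame (quotient_endo phi) (quotient_endo psi),
      tame (torsion_endo phi) (torsion_endo psi)
    & reidemeister_zeta K phi psi =
      additive_convolution
        (reidemeister_zeta K (quotient_endo phi) (quotient_endo psi))
        (reidemeister_zeta K (torsion_endo phi) (torsion_endo psi))].
Proof.
have refl n : (0 < n)%N -> forall x,
    (iter n psi \- iter n phi) x \in @torsion G -> x \in @torsion G.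
  move=> /htame/finite_twisted_classes_multiple; exact: torsion_reflected.
split=> [n n0|n n0|].
- rewrite !iter_quotient_endo.
  exact/quotient_twisted_classes_finite/htame.
- rewrite !iter_torsion_endo.
  exact: torsion_twisted_classes_finite (htame n n0) (refl n n0).
rewrite /reidemeister_zeta additive_convolutionE; apply: exp_series_ext => n n0.
rewrite !iter_quotient_endo !iter_torsion_endo -natrM; congr _%:R.
exact: reidemeister_number_mul (htame n n0) (refl n n0).
Qed.
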